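(* Let $N$ be a positive integer and $a\in\{1,2,\ldots,N\}$. For any integer $m>1$ and any integers $k\geq n\geq 1$, we have $$\sum_{\substack{k_1+\cdots+k_n=k\\ k_i\geq 1}}t_{N,a}(mk_1,\ldots,mk_n)=\sum_{j=0}^{k-n}(-1)^{k-n-j}\binom{k-j}{n}t^\star_{N,a}(\{m\}^j)\,t_{N,a}(\{m\}^{k-j}),$$ $$\sum_{\substack{k_1+\cdots+k_n=k\\ k_i\geq 1}}t^\star_{N,a}(mk_1,\ldots,mk_n)=\sum_{j=0}^{k-n}(-1)^{j}\binom{k-j}{n}t_{N,a}(\{m\}^j)\,t^\star_{N,a}(\{m\}^{k-j}).$$
   Context: For positive integers $k_1,\ldots,k_n$ with $k_1>1$, $$t_{N,a}(k_1,\ldots,k_n)=\sum_{m_1>\cdots>m_n>0,\ m_i\equiv a\ (\mathrm{mod}\ N)}\frac{1}{m_1^{k_1}\cdots m_n^{k_n}},\qquad t^\star_{N,a}(k_1,\ldots,k_n)=\sum_{m_1\geq\cdots\geq m_n>0,\ m_i\equiv a\ (\mathrm{mod}\ N)}\frac{1}{m_1^{k_1}\cdots m_n^{k_n}};$$ for the empty index both values are $1$. $\{m\}^j$ denotes $m$ repeated $j$ times (the empty index if $j=0$). *)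

(* Defs.v *)
From mathcomp Require Import all_boot all_order all_algebra.
From mathcomp Require Import all_classical all_reals all_analysis.

Set Implicit Arguments.
Unset Strict Implicit.
Unset Printing Implicit Defensive.

Import Order.TTheory GRing.Theory Num.Theory.
Local Open Scope classical_set_scope.
Local Open Scope ring_scope.

(* The sums below have nonnegative terms, so they are unordered sums
   [\esum] in [\bar R]; [fine] reads the (finite, when k_1 > 1) value in [R].
   It would return the junk value 0 on a divergent sum. *)

Definition mzv_term (R : realType) (n : nat) (k u : n.-tuple nat) : R :=
  1 / \prod_(i < n) (tnth u i)%:R ^+ tnth k i.

Definition strict_indices (N a n : nat) : set (n.-tuple nat) :=
  [set u : n.-tuple nat | sorted gtn u /\
           forall i, (0 < tnth u i)%N /\ (tnth u i = a %[mod N])%N].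

Definition weak_indices (N a n : nat) : set (n.-tuple nat) :=
  [set u : n.-tuple nat | sorted geq u /\
           forall i, (0 < tnth u i)%N /\ (tnth u i = a %[mod N])%N].

Arguments strict_indices : clear implicits.
Arguments weak_indices : clear implicits.

Definition t_val (R : realType) (N a n : nat) (k : n.-tuple nat) : R :=
  fine (\esum_(u in strict_indices N a n) (mzv_term R k u)%:E).

Definition tstar_val (R : realType) (N a n : nat) (k : n.-tuple nat) : R :=
  fine (\esum_(u in weak_indices N a n) (mzv_term R k u)%:E).

(* Parts of a composition of [k] are at most [k], so ['I_k.+1] loses none. *)
Definition is_composition (k n : nat) (c : n.-tuple 'I_k.+1) : bool :=
  (\sum_(i < n) tnth c i == k)%N && [forall i, 0 < tnth c i]%N.

Definition scale_index (m k n : nat) (c : n.-tuple 'I_k.+1) : n.-tuple nat :=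
  [tuple (m * tnth c i)%N | i < n].

(* Main.v *)
Require Import Defs.
From mathcomp Require Import all_boot all_order all_algebra.
From mathcomp Require Import ring lra zify.
From mathcomp Require Import all_classical all_reals all_analysis.

Set Implicit Arguments.
Unset Strict Implicit.
Unset Printing Implicit Defensive.

Import Order.TTheory GRing.Theory Num.Theory.
Import numFieldNormedType.Exports.
Local Open Scope ring_scope.

(* Truncate all sums to summation indices below M and put x_p = p^-m if
   p = a mod N, x_p = 0 otherwise.  With E(T) = prod (1 + x_p T) and
   H(T) = prod 1 / (1 - x_p T), the generating functions of the two left-hand
   sides (U marking the number of parts, T the total k) are
     prod (1 + U x_p T / (1 - x_p T)) = E((U - 1) T) H(T),
     prod 1 / (1 - U x_p T / (1 - x_p T)) = E(- T) H((1 + U) T),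
   whose coefficients are the two right-hand sides.  Both identities are checked
   coefficientwise by induction on M, each new factor giving a two-term
   recursion.  All exponents are at least 2, so the truncated sums are
   nondecreasing in M and bounded, and the identities pass to the limit. *)

(** * Cauchy products of coefficient sequences *)

Section Convolution.
Variable R : comNzRingType.
Implicit Types (f g d : nat -> R) (y : R) (k : nat).

Definition conv f g k : R := \sum_(j < k.+1) f j * g (k - j)%N.

Lemma convC f g k : conv f g k = conv g f k.
Proof.
rewrite /conv (reindex_inj rev_ord_inj); apply: eq_bigr => j _ /=.
have jk : (j <= k)%N by rewrite -ltnS.
by rewrite subSS (subKn jk) mulrC.
Qed.

Lemma eq_convl f1 f2 g k : f1 =1 f2 -> conv f1 g k = conv f2 g k.
Proof. by move=> e; apply: eq_bigr => j _; rewrite e. Qed.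

Lemma convDl f1 f2 g k :
  conv (fun j => f1 j + f2 j) g k = conv f1 g k + conv f2 g k.
Proof. by rewrite /conv -big_split; apply: eq_bigr => j _; rewrite mulrDl. Qed.

Lemma convZl y f g k : conv (fun j => y * f j) g k = y * conv f g k.
Proof. by rewrite /conv big_distrr /=; apply: eq_bigr => j _; rewrite mulrA. Qed.

(** In generating functions: [F' = F + y T D] gives [F' G = F G + y T D G]. *)
Lemma conv_shiftl f f' d g y k : f' 0%N = f 0%N ->
    (forall j, f' j.+1 = f j.+1 + y * d j) ->
  conv f' g k.+1 = conv f g k.+1 + y * conv d g k.
Proof.
move=> f'0 f'S; rewrite /conv !(big_ord_recl k.+1) /= f'0 -addrA; congr (_ + _).
rewrite big_distrr -big_split /=; apply: eq_bigr => j _.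
by rewrite /bump /= !add1n f'S subSS mulrDl mulrA.
Qed.

Lemma conv_unit f k : conv (fun j => (j == 0)%:R) f k = f k.
Proof.
rewrite /conv big_ord_recl mul1r subn0 big1 ?addr0 // => j _.
by rewrite mul0r.
Qed.

(* Passing from [e, h] to [e', h'] adjoins one variable [y] to the elementary and
   complete symmetric sums: [E' = (1 + y T) E] and [H' = H / (1 - y T)]. *)
Lemma conv_step_strict h h' e e' u v y k :
    h' 0%N = h 0%N -> (forall j, h' j.+1 = h j.+1 + y * h' j) ->
    e' 0%N = e 0%N -> (forall j, e' j.+1 = e j.+1 + y * e j) ->
    (forall l, u l.+1 = v l - u l) ->
  conv h' (fun l => e' l * u l) k.+1 =
    conv h (fun l => e l * u l) k.+1 + y * conv h (fun l => e l * v l) k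
    - y * conv h (fun l => e l * u l) k + y * conv h' (fun l => e' l * u l) k.
Proof.
move=> h0 hS e0 eS uS.
have S0 : e' 0%N * u 0%N = e 0%N * u 0%N by rewrite e0.
have SS l : e' l.+1 * u l.+1 = e l.+1 * u l.+1 + y * (e l * v l + -1 * (e l * u l)).
  by rewrite eS uS; ring.
rewrite (conv_shiftl _ _ h0 hS) convC.
rewrite (conv_shiftl (f := fun l => e l * u l) h k S0 SS).
by rewrite convDl convZl !(convC h); ring.
Qed.

(** Here [e] carries alternating signs, so it is multiplied by [1 - y T]. The weights sit on [h],
    whose recursion refers back to [h'], so the [v] term already includes the new variable. *)
Lemma conv_step_weak h h' e e' u v y k :
    h' 0%N = h 0%N -> (forall j, h' j.+1 = h j.+1 + y * h' j) ->
    e' 0%N = e 0%N -> (forall j, e' j.+1 = e j.+1 - y * e j) ->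
    (forall l, u l.+1 = v l + u l) ->
  conv e' (fun l => h' l * u l) k.+1 =
    conv e (fun l => h l * u l) k.+1 + y * conv e' (fun l => h' l * v l) k
    - y * conv e (fun l => h l * u l) k + y * conv e' (fun l => h' l * u l) k.
Proof.
move=> h0 hS e0 eS uS.
have S0 : h' 0%N * u 0%N = h 0%N * u 0%N by rewrite h0.
have SS l : h' l.+1 * u l.+1 = h l.+1 * u l.+1 + y * (h' l * v l + h' l * u l).
  by rewrite hS uS; ring.
have eS' l : e' l.+1 = e l.+1 + y * (-1 * e l) by rewrite eS; ring.
rewrite convC (conv_shiftl (f := fun l => h l * u l) e' k S0 SS).
rewrite convDl (convC _ e') (conv_shiftl (d := fun l => -1 * e l) _ _ e0 eS').
by rewrite convZl !(convC _ e'); ring.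
Qed.

(** The binomial weights vanish below [n], which yields the upper limit [k - n] of the right-hand
    sides. *)
Lemma conv_truncate f g n k :
    (n <= k)%N -> (forall l, (l < n)%N -> g l = 0) ->
  conv f g k = \sum_(0 <= j < (k - n).+1) f j * g (k - j)%N.
Proof.
move=> nk g0; rewrite /conv -(big_mkord xpredT (fun j => f j * g (k - j)%N)).
rewrite (big_cat_nat (n := (k - n).+1)) ?ltnS ?leq_subr //=.
rewrite [X in _ + X]big_nat_cond [X in _ + X]big1 ?addr0 // => j.
by case/andP => /andP[nj jk] _; rewrite g0 ?mulr0 //; lia.
Qed.

End Convolution.

(** * Truncated nested sums and their sums over compositions *)

Section TruncatedSums.
Variables (R : comNzRingType) (y : nat -> R).

(* [b = false] sums over [M > p_1 > p_2 > ...],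
   [b = true] over [M > p_1 >= p_2 >= ...]. *)
Fixpoint nested_sum (b : bool) (M : nat) (s : seq nat) : R :=
  if s is i :: s' then \sum_(p < M) y p ^+ i * nested_sum b (p + b) s' else 1.

Lemma nested_sum_nil b M : nested_sum b M [::] = 1. Proof. by []. Qed.

Lemma nested_sum_bound0 b i s : nested_sum b 0 (i :: s) = 0.
Proof. exact: big_ord0. Qed.

Lemma nested_sumS b M i s :
  nested_sum b M.+1 (i :: s) =
  nested_sum b M (i :: s) + y M ^+ i * nested_sum b (M + b) s.
Proof. by rewrite [LHS]big_ord_recr. Qed.

#[global] Arguments nested_sum : simpl never.

(* [K] only bounds the type of the parts; any [K > k] gives the same sum, and
   keeping it fixed lets recursions on [k] stay in one type. *)
Definition composition_sum (K n k : nat) (F : seq nat -> R) : R :=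
  \sum_(c : n.-tuple 'I_K |
      (\sum_(i < n) tnth c i == k)%N && [forall i, 0 < tnth c i]%N)
    F (map val c).

Lemma eq_composition_sum K n k F G : F =1 G ->
  composition_sum K n k F = composition_sum K n k G.
Proof. by move=> e; apply: eq_bigr => c _; rewrite e. Qed.

Lemma composition_sumD K n k F G :
  composition_sum K n k (fun s => F s + G s) =
  composition_sum K n k F + composition_sum K n k G.
Proof. exact: big_split. Qed.

Lemma composition_sumZ K n k r F :
  composition_sum K n k (fun s => r * F s) = r * composition_sum K n k F.
Proof. by rewrite /composition_sum big_distrr. Qed.

Lemma composition_sum0 K k F : composition_sum K 0 k F = (k == 0%N)%:R * F [::].
Proof.
rewrite /composition_sum big_mkcond /=.
rewrite (eq_bigr (fun=> (k == 0%N)%:R * F [::])) => [|c _].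
  by rewrite sumr_const card_tuple expn0 mulr1n.
rewrite big_ord0 eq_sym [c]tuple0 (_ : [forall i, _] = true) ?andbT.
  by case: eqP; rewrite ?mul1r ?mul0r.
by apply/forallP; case.
Qed.

(** Splits off the first part [i.+1]; since [k < K], every possible first part occurs in ['I_K]. *)
Lemma composition_sumS K n k F : (k < K)%N ->
  composition_sum K n.+1 k F =
  \sum_(i < k) composition_sum K n (k - i.+1) (fun s => F (i.+1 :: s)).
Proof.
move=> kK; rewrite /composition_sum.
set C := fun m l (c : m.-tuple 'I_K) =>
  (\sum_(i < m) tnth c i == l)%N && [forall i, 0 < tnth c i]%N.
have CS l i (c : n.-tuple 'I_K) :
    C n.+1 l (cons_tuple i c) = [&& 0 < i, i <= l & C n (l - i) c]%N.
  rewrite /C big_ord_recl tnth0.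
  under [X in (_ + X == _)%N]eq_bigr do rewrite tnthS.
  have -> : [forall j, 0 < tnth (cons_tuple i c) j]%N =
            (0 < i)%N && [forall j, 0 < tnth c j]%N.
    apply/forallP/andP => [pos|[i0 /forallP pos] j].
      split; first by have := pos ord0; rewrite tnth0.
      by apply/forallP => j; have := pos (lift ord0 j); rewrite tnthS.
    by case: (unliftP ord0 j) => [j' ->|->]; rewrite ?tnthS ?tnth0.
  have -> : (i + \sum_(j < n) tnth c j == l)%N =
            (i <= l)%N && (\sum_(j < n) tnth c j == l - i)%N.
    have [il|li] := leqP i l; first by rewrite -{1}(subnKC il) eqn_add2l.
    by apply/negbTE; rewrite neq_ltn (leq_trans li) ?orbT ?leq_addr.
  by rewrite andbACA (andbC (i <= l)%N) -andbA.
transitivity (\sum_(i < K) \sum_(c : n.-tuple 'I_K | C n.+1 k (cons_tuple i c))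
    F (val i :: map val c)).
  rewrite pair_big_dep.
  rewrite (reindex (fun q : 'I_K * n.-tuple 'I_K => cons_tuple q.1 q.2)) //.
  exists (fun c => (thead c, behead_tuple c)) => [[i c]|c] _.
    by congr (_, _); apply: val_inj.
  by rewrite /= [RHS]tuple_eta; apply: val_inj.
transitivity (\sum_(i < K) if (0 < i <= k)%N then
    \sum_(c : n.-tuple 'I_K | C n (k - i)%N c) F (val i :: map val c) else 0).
  apply: eq_bigr => i _; under eq_bigl do rewrite CS andbA.
  by case: ifP => _ //=; rewrite big_pred0_eq.
(* Extending the summand to all of [nat] lets the range be cut at [k.+1] and the vanishing term at 0
   be dropped. *)
pose G i : R := if (0 < i <= k)%N then
  \sum_(c : n.-tuple 'I_K | C n (k - i)%N c) F (i :: map val c) else 0.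
rewrite -(big_mkord xpredT G) (big_cat_nat (n := k.+1)) //=.
rewrite [X in _ + X]big_nat_cond [X in _ + X]big1 => [|i]; last first.
  by rewrite andbT /G => /andP[ki _]; rewrite [(i <= k)%N]leqNgt ki andbF.
rewrite addr0 big_nat_recl // {1}/G ltnn add0r big_mkord.
by apply: eq_bigr => i _; rewrite /G ltn_ord.
Qed.

Lemma composition_nested_sumS K b M n k : (k < K)%N ->
  composition_sum K n.+1 k (nested_sum b M.+1) =
  composition_sum K n.+1 k (nested_sum b M) +
  \sum_(i < k) y M ^+ i.+1 *
    composition_sum K n (k - i.+1) (nested_sum b (M + b)).
Proof.
move=> kK; rewrite !composition_sumS // -big_split; apply: eq_bigr => i _ /=.
under eq_composition_sum do rewrite nested_sumS.
by rewrite composition_sumD composition_sumZ.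
Qed.

(* The difference with [y M] times degree [k] cancels all but the first term of
   the geometric-type sum over the first part in [composition_nested_sumS]. *)
Lemma composition_nested_sum_step K b M n k : (k.+1 < K)%N ->
  composition_sum K n.+1 k.+1 (nested_sum b M.+1) =
  composition_sum K n.+1 k.+1 (nested_sum b M)
  + y M * composition_sum K n k (nested_sum b (M + b))
  - y M * composition_sum K n.+1 k (nested_sum b M)
  + y M * composition_sum K n.+1 k (nested_sum b M.+1).
Proof.
move=> kK; rewrite !composition_nested_sumS ?(ltnW kK) //.
rewrite big_ord_recl subSS subn0 expr1 [in RHS]mulrDr.
have -> : \sum_(i < k) y M ^+ (lift ord0 i).+1 *
      composition_sum K n (k.+1 - (lift ord0 i).+1) (nested_sum b (M + b)) =
    y M * \sum_(i < k) y M ^+ i.+1 *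
      composition_sum K n (k - i.+1) (nested_sum b (M + b)).
  rewrite [RHS]big_distrr; apply: eq_bigr => i _ /=.
  by rewrite /bump add1n subSS exprS mulrA.
ring.
Qed.

Lemma composition_nested_sum00 K b M n :
  composition_sum K n.+1 0 (nested_sum b M) = 0.
Proof.
rewrite /composition_sum big_pred0 // => c; apply/negbTE/negP.
case/andP => /eqP; rewrite big_ord_recl => /eqP; rewrite addn_eq0.
by case/andP=> /eqP c0 _ /forallP /(_ ord0); rewrite c0.
Qed.

Lemma composition_nested_sum_bound0 K b n k : (k < K)%N ->
  composition_sum K n k (nested_sum b 0) = ((n == 0) && (k == 0))%N%:R.
Proof.
move=> kK; case: n => [|n]; first by rewrite composition_sum0 /= mulr1.
rewrite composition_sumS //= big1 // => i _.
under eq_composition_sum do rewrite nested_sum_bound0.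
by rewrite /composition_sum big1.
Qed.

(** * The truncated identities; [h] and [e] are the complete and elementary symmetric sums of the
    [y p] with [p < M] *)

Let h M j := nested_sum true M (nseq j 1%N).
Let e M j := nested_sum false M (nseq j 1%N).

Let hS M j : h M.+1 j.+1 = h M j.+1 + y M * h M.+1 j.
Proof. by rewrite {1}/h nested_sumS addn1 expr1. Qed.

Let eS M j : e M.+1 j.+1 = e M j.+1 + y M * e M j.
Proof. by rewrite {1}/e nested_sumS addn0 expr1. Qed.

(** The coefficient of [U^n] in [(U - 1)^l]. *)
Definition signed_bin (l n : nat) : R := (-1) ^+ (l - n) * 'C(l, n)%:R.

Lemma signed_binS l n : signed_bin l.+1 n.+1 = signed_bin l n - signed_bin l n.+1.
Proof.
rewrite /signed_bin subSS binS natrD mulrDr addrC; congr (_ + _).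
have [ln|nl] := leqP l n; first by rewrite bin_small ?ltnS // !mulr0 oppr0.
by rewrite subnS -(prednK (n := l - n)) ?subn_gt0 // exprS !mulNr mul1r.
Qed.

(** Both sides obey the same recursion. It refers to [M.+1] again in degree [k], hence an inner
    induction on [k] within the induction on [M]. *)
Lemma composition_nested_sum_strict K M n k : (k < K)%N ->
  composition_sum K n k (nested_sum false M) =
  conv (h M) (fun l => e M l * signed_bin l n) k.
Proof.
elim: M n k => [|M IHM] n k kK.
  rewrite composition_nested_sum_bound0 //.
  rewrite (@eq_convl _ _ (fun j => (j == 0)%:R)) => [|[|j]]; rewrite ?conv_unit //.
    case: k kK => [|k] _; rewrite /signed_bin /e ?nested_sum_bound0 ?mul0r ?andbF //.
    by rewrite sub0n mul1r mul1r bin0n andbT.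
  by rewrite /h nested_sum_bound0.
elim: k kK => [|k IHk] kK.
  rewrite /conv big_ord1 /h /e !nested_sum_nil !mul1r sub0n /signed_bin mul1r bin0n.
  by case: n => [|n]; rewrite ?composition_sum0 ?composition_nested_sum00 ?mul1r.
case: n IHk => [|n] IHk.
  (* For [n = 0] the weights are [(-1)^l], so [v = 0], and the claim is the vanishing of
     [E(-T) H(T)] in positive degree. *)
  rewrite composition_sum0 mul0r.
  rewrite (@conv_step_strict _ (h M) (h M.+1) (e M) (e M.+1) _
    (fun=> 0) (y M)) //; last first.
    by move=> l; rewrite /signed_bin !subn0 !bin0 exprS; ring.
  rewrite -IHk 1?ltnW // -!IHM // 1?ltnW // !composition_sum0 /=.
  rewrite /conv big1 => [|j _]; last by rewrite !mulr0.
  ring.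
rewrite composition_nested_sum_step // addn0 IHk 1?ltnW // !IHM // 1?ltnW //.
by rewrite (@conv_step_strict _ (h M) (h M.+1) (e M) (e M.+1) _
    (signed_bin^~ n) (y M)) // => l;
  exact: signed_binS.
Qed.

Lemma composition_nested_sum_weak K M n k : (k < K)%N ->
  composition_sum K n k (nested_sum true M) =
  conv (fun j => (-1) ^+ j * e M j) (fun l => h M l * 'C(l, n)%:R) k.
Proof.
elim: M n k => [|M IHM] n k kK.
  rewrite composition_nested_sum_bound0 //.
  rewrite (@eq_convl _ _ (fun j => (j == 0)%:R)) => [|[|j]]; rewrite ?conv_unit //.
  - case: k kK => [|k] _; rewrite /h ?nested_sum_bound0 ?mul0r ?andbF //.
    by rewrite mul1r bin0n andbT.
  - by rewrite mul1r.
  - by rewrite /e nested_sum_bound0 mulr0.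
have eS' j : (-1) ^+ j.+1 * e M.+1 j.+1 =
    (-1) ^+ j.+1 * e M j.+1 - y M * ((-1) ^+ j * e M j).
  by rewrite eS exprS; ring.
have step n' v k' (H : forall l, 'C(l.+1, n')%:R = v l + 'C(l, n')%:R :> R) :=
  @conv_step_weak R (h M) (h M.+1) (fun j => (-1) ^+ j * e M j)
    (fun j => (-1) ^+ j * e M.+1 j) (fun l => 'C(l, n')%:R) v (y M) k'
    erefl (hS M) erefl eS' H.
(* Now [n] must vary: weak chains may repeat [M], so the recursion also calls the bound [M.+1] with
   one part fewer. *)
elim: k n kK => [|k IHk] n kK.
  rewrite /conv big_ord1 /h /e !nested_sum_nil !mul1r bin0n.
  by case: n => [|n]; rewrite ?composition_sum0 ?composition_nested_sum00 ?mul1r.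
case: n => [|n].
  rewrite composition_sum0 mul0r (step _ (fun=> 0)) => [|l]; last first.
    by rewrite !bin0 add0r.
  rewrite -IHk 1?ltnW // -!IHM // 1?ltnW // !composition_sum0 /=.
  rewrite [conv _ (fun l => h M.+1 l * 0) _]big1 => [|j _]; last by rewrite !mulr0.
  ring.
rewrite composition_nested_sum_step // addn1 !IHk 1?ltnW // !IHM // 1?ltnW //.
by rewrite (step _ (fun l => 'C(l, n)%:R)) // => l; rewrite binS natrD addrC.
Qed.

Lemma truncated_strict_identity M n k : (n <= k)%N ->
  composition_sum k.+1 n k (nested_sum false M) =
  \sum_(0 <= j < (k - n).+1) (-1) ^+ (k - n - j) * 'C(k - j, n)%:R *
    nested_sum true M (nseq j 1%N) * nested_sum false M (nseq (k - j) 1%N).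
Proof.
move=> nk; rewrite composition_nested_sum_strict // (conv_truncate _ nk).
  by apply: eq_bigr => j _; rewrite /signed_bin subnAC /h /e; ring.
by move=> l ln; rewrite /signed_bin bin_small // !mulr0.
Qed.

Lemma truncated_weak_identity M n k : (n <= k)%N ->
  composition_sum k.+1 n k (nested_sum true M) =
  \sum_(0 <= j < (k - n).+1) (-1) ^+ j * 'C(k - j, n)%:R *
    nested_sum false M (nseq j 1%N) * nested_sum true M (nseq (k - j) 1%N).
Proof.
move=> nk; rewrite composition_nested_sum_weak // (conv_truncate _ nk).
  by apply: eq_bigr => j _; rewrite /h /e; ring.
by move=> l ln; rewrite bin_small // mulr0.
Qed.

End TruncatedSums.

(** * Convergence of the truncated sums to the infinite ones *)

Section Truncation.
Variables (R : realType) (N a : nat).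
Implicit Types (b : bool) (M p : nat).

Definition residue p := (0 < p)%N && (p == a %[mod N])%N.

(** The value 0 off the residue class lets the nested sums run over all [p < M] when the exponents
    are positive. *)
Definition recip p : R := if residue p then p%:R^-1 else 0.

(** Adding [b] to the bound covers both cases: strict decrease for [false], weak decrease for
    [true]. *)
Definition chain b (u : seq nat) :=
  sorted (fun p q => q < p + b)%N u && all residue u.

Definition recip_prod n (k u : n.-tuple nat) : R :=
  \prod_(i < n) recip (tnth u i) ^+ tnth k i.

Lemma recip_ge0 p : 0 <= recip p.
Proof. by rewrite /recip; case: ifP => // _; rewrite invr_ge0. Qed.

Lemma recip_le1 p : recip p <= 1.
Proof.
rewrite /recip /residue; case: p => //= p.
by case: ifP => // _; rewrite invf_le1 ?ler1n.
Qed.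

Lemma recip_prod_ge0 n (k u : n.-tuple nat) : 0 <= recip_prod k u.
Proof. by apply: prodr_ge0 => i _; apply: exprn_ge0; exact: recip_ge0. Qed.

Lemma nested_recip_ge0 b M s : 0 <= nested_sum recip b M s.
Proof.
elim: s M => [|i s IHs] M; first by rewrite nested_sum_nil.
by apply: sumr_ge0 => p _; rewrite mulr_ge0 ?exprn_ge0 ?recip_ge0.
Qed.

Lemma sum_recip_sq_le2 M : \sum_(p < M) recip p ^+ 2 <= 2.
Proof.
have sqS p : recip p.+1 ^+ 2 <= p.+1%:R ^- 2.
  by rewrite /recip; case: ifP => _; rewrite ?exprVn // expr0n invr_ge0 exprn_ge0.
case: M => [|[|M]]; rewrite ?big_ord0 // big_ord_recl {1}/recip /= expr0n add0r.
  by rewrite big_ord0.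
(* The sharper bound is what makes the induction close: [1/(t+1)^2] is at most [1/t - 1/(t+1)]. *)
apply: (@le_trans _ _ (2 - M.+1%:R^-1)); last by rewrite gerBl invr_ge0.
elim: M => [|M IHM].
  by rewrite big_ord1; apply: le_trans (sqS _) _; rewrite expr1n invr1; lra.
rewrite big_ord_recr /=; apply: le_trans (lerD IHM (sqS _)) _.
rewrite -[M.+2%:R]natr1; set t : R := M.+1%:R; have t0 : 0 < t by rewrite ltr0n.
rewrite -subr_ge0.
have -> : 2 - (t + 1)^-1 - (2 - t^-1 + (t + 1) ^- 2) = (t * (t + 1) ^+ 2)^-1.
  by field; rewrite !gt_eqF // addr_gt0.
by rewrite invr_ge0 mulr_ge0 ?exprn_ge0 ?addr_ge0 // ltW.
Qed.

(** As [recip p] is at most 1, each exponent can be lowered to 2, so every nesting level costs a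
    factor of at most 2. *)
Lemma nested_recip_le b M s : all (leq 2) s ->
  nested_sum recip b M s <= 2 ^+ size s.
Proof.
elim: s M => [|i s IHs] M /=; first by rewrite nested_sum_nil.
case/andP => i2 /IHs {}IHs; rewrite exprS.
apply: (@le_trans _ _ (\sum_(p < M) recip p ^+ 2 * 2 ^+ size s)).
  apply: ler_sum => p _; apply: ler_pM; rewrite ?exprn_ge0 ?recip_ge0 //.
    exact: nested_recip_ge0.
  by rewrite ler_wiXn2l ?recip_ge0 ?recip_le1.
by rewrite -mulr_suml ler_wpM2r ?exprn_ge0 ?sum_recip_sq_le2.
Qed.

Local Open Scope classical_set_scope.

(** The head dominates a chain, so [M] only has to bound [p], and [p + b] then bounds the tail as in
    [nested_sum]. *)
Lemma chain_cons b M p u :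
  chain b (p :: u) && all (ltn^~ M) (p :: u) =
  [&& (p < M)%N, residue p, chain b u & all (ltn^~ (p + b)%N) u].
Proof.
rewrite /chain /= path_sortedE; last first.
  by move=> q1 q2 q3; case: b => /=; rewrite ?addn1 ?addn0; lia.
case pM: (p < M)%N; last by rewrite !andbF.
case: (residue p); rewrite ?andbF //=.
case: (sorted _ _); rewrite ?andbF //= andbT.
case: (all residue u); rewrite ?andbF //= andbT.
case E: (all _ u) => //=; apply/allP => q /(allP E).
by case: b {E} => /=; rewrite ?addn1 ?addn0; lia.
Qed.

(** The factor [r] collects the terms of indices already split off, so the induction hypothesis
    applies under the outer sum. *)
Lemma esum_chain_below b M n (k : n.-tuple nat) (r : R) :
    0 <= r -> all (leq 1) k ->
  \esum_(u in [set u : n.-tuple nat | chain b u && all (ltn^~ M) u])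
     (r * recip_prod k u)%:E =
  (r * nested_sum recip b M k)%:E.
Proof.
elim: n k r M => [|n IHn] k r M r0.
  move=> _; rewrite [k]tuple0 nested_sum_nil.
  rewrite (_ : [set u | _] = [set [tuple]]) ?esum_set1.
  - by rewrite /recip_prod big_ord0.
  - by rewrite lee_fin mulr_ge0 ?recip_prod_ge0.
  - by apply/seteqP; split => u _ /=; rewrite [u]tuple0.
case/tupleP: k => i k /= /andP[i0 k0].
rewrite (@reindex_esum R _ _ ([set p | residue p && (p < M)%N] `*``
    (fun p => [set u : n.-tuple nat | chain b u && all (ltn^~ (p + b)%N) u]))
    _ (fun q => cons_tuple q.1 q.2)); last first.
  split.
  - by case=> p u /= [/andP[rp pM] u1]; rewrite chain_cons pM rp.
  - by case=> p u [q v] _ _ /= /(congr1 val) /= [-> /val_inj ->].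
  - case/tupleP => p u /= ; rewrite chain_cons => /and4P[pM rp u1 u2].
    by exists (p, u) => /=; [rewrite rp pM u1 u2|apply: val_inj].
rewrite -(esum_esum (a := fun p u =>
    (r * recip_prod (cons_tuple i k) (cons_tuple p u))%:E)); last first.
  by move=> p u _ _; rewrite lee_fin mulr_ge0 ?recip_prod_ge0.
under eq_esum => p _.
  under eq_esum => u _.
    rewrite /recip_prod big_ord_recl !tnth0 mulrA.
    under eq_bigr do rewrite !tnthS.
    over.
  rewrite IHn ?mulr_ge0 ?exprn_ge0 ?recip_ge0 //.
  over.
rewrite (_ : [set p | _] = [set p | residue p] `&` `I_M); last first.
  by apply/seteqP; split => p /= /andP.
rewrite esum_mkcondl.
rewrite (@eq_esum _ _ _ _ (fun p =>
    (r * recip p ^+ i * nested_sum recip b (p + b) k)%:E)); last first.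
  move=> p _; case: ifPn => //; rewrite notin_setE /= => /negP/negbTE rp.
  by rewrite /recip rp expr0n gtn_eqF // mulr0 mul0r.
rewrite esum_fset //; last first.
  by move=> p _; rewrite lee_fin !mulr_ge0 ?exprn_ge0 ?recip_ge0 ?nested_recip_ge0.
rewrite -fsbig_ord sumEFin big_distrr /=.
by congr (_%:E); apply: eq_bigr => p _; rewrite mulrA.
Qed.

(** Any finite set of chains lies below some [M], so the unordered sum is the supremum of the
    nondecreasing truncations. The uniform bound makes it finite, so [fine] returns its true
    value. *)
Lemma cvg_nested_recip b n (k : n.-tuple nat) : all (leq 2) k ->
  nested_sum recip b M k @[M --> \oo] -->
    fine (\esum_(u in [set u : n.-tuple nat | chain b u]) (recip_prod k u)%:E).
Proof.
move=> k2; have k1 : all (leq 1) k by apply: sub_all k2 => i /ltnW.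
set S := esum _ _.
have below M : \esum_(u in [set u : n.-tuple nat | chain b u && all (ltn^~ M) u])
    (recip_prod k u)%:E = (nested_sum recip b M k)%:E.
  rewrite -[nested_sum _ _ _ _]mul1r -esum_chain_below //.
  by apply: eq_esum => u _; rewrite mul1r.
have mono (A B : set (n.-tuple nat)) : A `<=` B ->
    (\esum_(u in A) (recip_prod k u)%:E <= \esum_(u in B) (recip_prod k u)%:E)%E.
  move=> AB; apply: ge_ereal_sup => _ [X [finX XA] <-].
  by apply: esum_ge; exists X => //; split=> // u /XA /AB.
have SE : S = ereal_sup (range (fun M => (nested_sum recip b M k)%:E)).
  apply/eqP; rewrite eq_le; apply/andP; split; apply: ge_ereal_sup.
    move=> _ [X [/finite_seqP[s ->] Xs] <-].
    pose M := (\max_(u <- s) \max_(p <- u) p).+1.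
    apply: (@le_trans _ _ (nested_sum recip b M k)%:E); last first.
      by apply: ereal_sup_ubound; exists M.
    rewrite -below; apply: esum_ge; exists [set` s] => //; split => // u us /=.
    rewrite (Xs _ us); apply/allP => p pu /=.
    rewrite ltnS (leq_trans _ (@leq_bigmax_seq _ _ xpredT
      (fun u : n.-tuple nat => \max_(p <- u) p)%N u us _)) //.
    by rewrite (@leq_bigmax_seq _ _ xpredT id).
  by move=> _ [M _ <-]; rewrite -below; apply: mono => u /= /andP[].
have S_le : (S <= (2 ^+ size k)%:E)%E.
  by rewrite SE; apply: ge_ereal_sup => _ [M _ <-]; rewrite lee_fin nested_recip_le.
have S_fin : S \is a fin_num.
  rewrite ge0_fin_numE ?(le_lt_trans S_le) ?ltry //.
  by apply: esum_ge0 => u _; rewrite lee_fin recip_prod_ge0.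
suff : (nested_sum recip b M k)%:E @[M --> \oo] --> (fine S)%:E by move/fine_cvg.
rewrite fineK // SE; apply: ereal_nondecreasing_cvgn.
move=> M1 M2 M12; rewrite -!below; apply: mono => u /= /andP[-> /=].
by apply: sub_all => p /= /leq_trans; apply.
Qed.

Lemma mzv_term_recip b n (k u : n.-tuple nat) : chain b u ->
  mzv_term R k u = recip_prod k u.
Proof.
case/andP => _ /all_tnthP ru; rewrite /mzv_term /recip_prod div1r -prodfV.
by apply: eq_bigr => i _; rewrite /recip ru exprVn.
Qed.

Lemma residueP n (u : n.-tuple nat) :
  (forall i, (0 < tnth u i)%N /\ (tnth u i = a %[mod N])%N) <-> all residue u.
Proof.
split=> [ru|/all_tnthP ru i]; last by have /andP[? /eqP] := ru i.
by apply/all_tnthP => i; have [? /eqP ?] := ru i; apply/andP.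
Qed.

Lemma strict_indicesE n :
  strict_indices N a n = [set u : n.-tuple nat | chain false u].
Proof.
apply/seteqP; split=> u; rewrite /strict_indices /chain /= residueP;
  rewrite (@eq_sorted _ _ gtn) => [|p q]; rewrite ?addn0 //.
  by case=> -> ->.
by case/andP.
Qed.

Lemma weak_indicesE n :
  weak_indices N a n = [set u : n.-tuple nat | chain true u].
Proof.
apply/seteqP; split=> u; rewrite /weak_indices /chain /= residueP;
  rewrite (@eq_sorted _ _ geq) => [|p q]; rewrite ?addn1 //.
  by case=> -> ->.
by case/andP.
Qed.

Lemma cvg_t_val n (k : n.-tuple nat) : all (leq 2) k ->
  nested_sum recip false M k @[M --> \oo] --> t_val R N a k.
Proof.
move/(cvg_nested_recip (b := false)); rewrite /t_val strict_indicesE.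
rewrite [in X in _ -> X](eq_esum (a := fun u => (mzv_term R k u)%:E)
  (b := fun u => (recip_prod k u)%:E)) // => u cu.
by rewrite (mzv_term_recip _ cu).
Qed.

Lemma cvg_tstar_val n (k : n.-tuple nat) : all (leq 2) k ->
  nested_sum recip true M k @[M --> \oo] --> tstar_val R N a k.
Proof.
move/(cvg_nested_recip (b := true)); rewrite /tstar_val weak_indicesE.
rewrite [in X in _ -> X](eq_esum (a := fun u => (mzv_term R k u)%:E)
  (b := fun u => (recip_prod k u)%:E)) // => u cu.
by rewrite (mzv_term_recip _ cu).
Qed.

End Truncation.

(** Absorbing [m] into the variables reduces scaled compositions to plain ones and [{m}^j] to
    [{1}^j]. *)
Lemma nested_sum_pow (R : comNzRingType) (x : nat -> R) m b M s :
  nested_sum x b M (map (muln m) s) = nested_sum (fun p => x p ^+ m) b M s.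
Proof.
elim: s M => [|i s IHs] M; first by rewrite nested_sum_nil.
by apply: eq_bigr => p _; congr (_ * _); [exact: exprM|exact: IHs].
Qed.

Lemma map_nseq_mul m j : map (muln m) (nseq j 1%N) = nseq j m.
Proof. by rewrite map_nseq muln1. Qed.

Lemma composition_all_pos k n (c : n.-tuple 'I_k.+1) :
  is_composition c -> all (leq 1) (map val c).
Proof.
case/andP => _ /forallP c_pos; rewrite all_map.
by apply/all_tnthP => i; exact: c_pos.
Qed.

Lemma scale_indexE m k n (c : n.-tuple 'I_k.+1) :
  scale_index m c = map (muln m) (map val c) :> seq nat.
Proof.
rewrite -[RHS]/(val (map_tuple (muln m) (map_tuple val c))); congr val.
by apply: eq_from_tnth => i; rewrite !tnth_map tnth_ord_tuple.
Qed.

(** * Passage to the limit on both sides *)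

Section Limits.
Variables (R : realType) (N a m : nat).
Hypothesis m1 : (1 < m)%N.
Local Open Scope classical_set_scope.

Let y p : R := recip R N a p ^+ m.

(** Abstracting [v] serves [t_val] and [tstar_val] alike; positive parts times [m] give exponents of
    at least 2. *)
Lemma cvg_composition_sum b (v : forall n, n.-tuple nat -> R) k n :
    (forall n (s : n.-tuple nat), all (leq 2) s ->
       nested_sum (recip R N a) b M s @[M --> \oo] --> v n s) ->
  composition_sum k.+1 n k (nested_sum y b M) @[M --> \oo] -->
    \sum_(c : n.-tuple 'I_k.+1 | is_composition c) v n (scale_index m c).
Proof.
move=> cv_v; apply: (cvg_big (@add_continuous R)) => c /composition_all_pos c1.
rewrite (_ : (fun M => _) =
    (fun M => nested_sum (recip R N a) b M (scale_index m c))).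
  apply: cv_v; rewrite scale_indexE all_map; apply: sub_all c1 => i /= i0.
  by rewrite (leq_trans m1) // leq_pmulr.
by apply/funext => M; rewrite scale_indexE nested_sum_pow.
Qed.

Lemma cvg_nseq b (v : forall n, n.-tuple nat -> R) j :
    (forall n (s : n.-tuple nat), all (leq 2) s ->
       nested_sum (recip R N a) b M s @[M --> \oo] --> v n s) ->
  nested_sum y b M (nseq j 1%N) @[M --> \oo] --> v j (nseq_tuple j m).
Proof.
move=> cv_v; rewrite (_ : (fun M => _) =
    (fun M => nested_sum (recip R N a) b M (nseq_tuple j m))).
  by apply: cv_v; rewrite all_nseq m1 orbT.
by apply/funext => M; rewrite /= -(map_nseq_mul m j) nested_sum_pow.
Qed.

End Limits.

Theorem proposition3p5 (R : realType) (N a : nat)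
    (hN : (0 < N)%N) (ha : (1 <= a <= N)%N)
    (m k n : nat) (hm : (1 < m)%N) (hn : (1 <= n)%N) (hnk : (n <= k)%N) :
  \sum_(c : n.-tuple 'I_k.+1 | is_composition c)
      t_val R N a (scale_index m c)
    = \sum_(0 <= j < (k - n).+1)
        (-1) ^+ (k - n - j) * 'C(k - j, n)%:R
          * tstar_val R N a (nseq_tuple j m)
          * t_val R N a (nseq_tuple (k - j) m)
  /\
  \sum_(c : n.-tuple 'I_k.+1 | is_composition c)
      tstar_val R N a (scale_index m c)
    = \sum_(0 <= j < (k - n).+1)
        (-1) ^+ j * 'C(k - j, n)%:R
          * t_val R N a (nseq_tuple j m)
          * tstar_val R N a (nseq_tuple (k - j) m).
Proof.
have cvt := @cvg_t_val R N a; have cvts := @cvg_tstar_val R N a.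
have t_nseq j := cvg_nseq (j := j) hm cvt.
have ts_nseq j := cvg_nseq (j := j) hm cvts.
have lim_t := cvg_composition_sum (k := k) (n := n) hm cvt.
have lim_ts := cvg_composition_sum (k := k) (n := n) hm cvts.
split.
(* By uniqueness of limits, it suffices that the truncated left-hand sides, rewritten by the finite
   identity, converge to the right-hand side. *)
- apply: (cvg_unique (@norm_hausdorff _ _) lim_t).
  rewrite (funext (fun M => truncated_strict_identity _ M hnk)).
  apply: (cvg_big (@add_continuous R)) => j _.
  by apply: cvgM => //; apply: cvgM => //; apply: cvg_cst.
- apply: (cvg_unique (@norm_hausdorff _ _) lim_ts).
  rewrite (funext (fun M => truncated_weak_identity _ M hnk)).
  apply: (cvg_big (@add_continuous R)) => j _.
  by apply: cvgM => //; apply: cvgM => //; apply: cvg_cst.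
Qed.
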